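(* Assume that there exist constants $M>0$, $V_1\ge0$ and $V_2\ge0$ such that, for any integer $k\ge2$, $$\mathbb E\big[(G_{X_1}(X_1))^k\big]\le\frac{k!}{2}V_1M^{k-2}\quad\text{and}\quad \mathbb E\big[(G_\varepsilon(\varepsilon))^k\big]\le\frac{k!}{2}V_2M^{k-2}.$$ Let $V=V_1(K_{n-1}(\rho))^2+V_2\sum_{k=2}^n(K_{n-k}(\rho))^2$ and $\Delta=MK_{n-1}(\rho)$. Then, for any $t\in[0,\Delta^{-1})$, $$\mathbb E[e^{\pm tS_n}]\le\exp\left(\frac{t^2V}{2(1-t\Delta)}\right).$$ Consequently, for any $x>0$, $$\mathbb P(\pm S_n\ge x)\le\exp\left(-\frac{x^2}{V(1+\sqrt{1+2x\Delta/V})+x\Delta}\right)\le\exp\left(-\frac{x^2}{2(V+x\Delta)}\right).$$ (If $V=0$, the term $V(1+\sqrt{1+2x\Delta/V})$ is read as $0$.)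
   Context: $(\mathcal X,d)$ and $(\mathcal Y,\delta)$ are complete separable metric spaces; $(\varepsilon_i)_{i\ge1}$ is a sequence of iid $\mathcal Y$-valued random variables; $X_1$ is an $\mathcal X$-valued random variable independent of $(\varepsilon_i)_{i\ge2}$. The Markov chain is $X_n=F(X_{n-1},\varepsilon_n)$ for $n\ge2$, where $F:\mathcal X\times\mathcal Y\to\mathcal X$ is measurable and satisfies, for some $\rho\in[0,1)$ and $C>0$, $\mathbb E[d(F(x,\varepsilon_1),F(x',\varepsilon_1))]\le\rho\,d(x,x')$ for all $x,x'\in\mathcal X$, and $d(F(x,y),F(x,y'))\le C\,\delta(y,y')$ for all $x\in\mathcal X$, $y,y'\in\mathcal Y$. Fix $n\ge1$ and $f:\mathcal X^n\to\mathbb R$ with $|f(x_1,\ldots,x_n)-f(x_1',\ldots,x_n')|\le d(x_1,x_1')+\cdots+d(x_n,x_n')$, and let $S_n=f(X_1,\ldots,X_n)-\mathbb E[f(X_1,\ldots,X_n)]$. Let $P_{X_1}$ be the law of $X_1$, $P_\varepsilon$ the common law of the $\varepsilon_k$'s, $G_{X_1}(x)=\int d(x,x')P_{X_1}(dx')$, $G_\varepsilon(y)=\int C\,\delta(y,y')P_\varepsilon(dy')$; $G_\varepsilon(\varepsilon)$ denotes a random variable distributed as $G_\varepsilon(\varepsilon_k)$. For $k\in\mathbb N$, $K_k(\rho)=1+\rho+\cdots+\rho^k$. Statements with $\pm$ hold for each of the two signs. *)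

(* Defs.v *)
From HB Require Import structures.
From mathcomp Require Import all_boot all_order all_algebra.
From mathcomp Require Import all_classical all_reals all_analysis.

Set Implicit Arguments.
Unset Strict Implicit.
Unset Printing Implicit Defensive.

Import Order.TTheory GRing.Theory Num.Theory.

Local Open Scope classical_set_scope.
Local Open Scope ring_scope.

(* The point carried by the structure Complete is no restriction here: the
   space receives a random variable, hence is nonempty. *)
#[short(type="completeMetricType")]
HB.structure Definition CompleteMetric (K : numDomainType) :=
  { T of Complete T & Metric K T }.

Definition separable_space (T : topologicalType) : Prop :=
  exists2 D : set T, countable D & dense D.

(* The underlying space equipped with its Borel sigma-algebra. *)
Notation borel T := (g_sigma_algebraType (@open T)).

Section independence.
Context {d d1 d2 : measure_display} {Omega : measurableType d}
  {T1 : measurableType d1} {T2 : measurableType d2} {R : realType}.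
Variable P : probability Omega R.

Definition mutually_independent (D : set nat) (Z : nat -> {RV P >-> T1}) :=
  forall (J : seq nat) (A : nat -> set T1),
    uniq J -> (forall i, i \in J -> D i) ->
    (forall i, i \in J -> measurable (A i)) ->
    P (\bigcap_(i in [set` J]) (Z i @^-1` A i)) =
    (\prod_(i <- J) P (Z i @^-1` A i))%E.

Definition identically_distributed (D : set nat) (Z : nat -> {RV P >-> T1}) :=
  forall i j, D i -> D j ->
    forall A : set T1, measurable A ->
      distribution P (Z i) A = distribution P (Z j) A.

Definition iid (D : set nat) (Z : nat -> {RV P >-> T1}) :=
  mutually_independent D Z /\ identically_distributed D Z.

Definition generated_sigma_algebra (D : set nat) (Z : nat -> {RV P >-> T1}) :
    set (set Omega) :=
  <<s \bigcup_(i in D) preimage_set_system setT (Z i) measurable >>.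

Definition independent_of_family (X : {RV P >-> T2}) (D : set nat)
    (Z : nat -> {RV P >-> T1}) :=
  forall (A : set T2) (B : set Omega),
    measurable A -> generated_sigma_algebra D Z B ->
    P ((X @^-1` A) `&` B) = (P (X @^-1` A) * P B)%E.

End independence.

(* G_{X_1} is mean_dist 1 P_{X_1} and G_eps is mean_dist C P_eps; the value is
   +oo where the integral diverges. *)
Definition mean_dist (R : realType) (T : completeMetricType R) (c : R)
    (mu : probability (borel T) R) (x : T) : \bar R :=
  (\int[mu]_(x' in [set: borel T]) (c * mdist x x')%:E)%E.

Definition geomsum (R : realType) (rho : R) (k : nat) : R :=
  \sum_(0 <= i < k.+1) rho ^+ i.

Section bernstein_constants.
Context {R : realType}.

Definition bernstein_V (n : nat) (rho V1 V2 : R) : R :=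
  V1 * geomsum rho n.-1 ^+ 2 +
  V2 * \sum_(2 <= k < n.+1) geomsum rho (n - k) ^+ 2.

Definition bernstein_Delta (n : nat) (rho M : R) : R := M * geomsum rho n.-1.

(* Division by 0 gives 0, so for V = 0 the first summand is 0 * 2 = 0. *)
Definition bernstein_denom (V Delta x : R) : R :=
  V * (1 + Num.sqrt (1 + 2 * x * Delta / V)) + x * Delta.

End bernstein_constants.

(* fine is harmless as long as Z is integrable; it returns 0 on +oo and -oo. *)
Definition centered d (Omega : measurableType d) (R : realType)
    (P : probability Omega R) (Z : Omega -> R) : Omega -> R :=
  fun w => Z w - fine ('E_P[Z])%E.

(* Main.v *)
Require Import Defs.
From HB Require Import structures.
From mathcomp Require Import all_boot all_order all_algebra.
From mathcomp Require Import all_classical all_reals all_analysis.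
From mathcomp Require Import measurable_realfun.
From mathcomp Require Import ring lra zify.

Set Implicit Arguments.
Unset Strict Implicit.
Unset Printing Implicit Defensive.

Import Order.TTheory GRing.Theory Num.Theory.
Import numFieldNormedType.Exports.

Local Open Scope classical_set_scope.
Local Open Scope ring_scope.

(** The centred functional is a sum of martingale increments, one per innovation,
and every increment is controlled by a single random variable with known
moments.  Let g_n = f and let g_(k-1) (x_1, .., x_(k-1)) be the mean of
g_k (x_1, .., x_(k-1), F (x_(k-1), y)) over y distributed as the innovations.
Averaging with the contraction F turns the Lipschitz constant a of g_k in its
newest coordinate into 1 + rho * a in the newest coordinate of g_(k-1), and
leaves the constant 1 in the older coordinates ([average_lipschitz]).  As
K_(j+1) = 1 + rho * K_j, the constant at time k is K_(n-k).  Hence the increment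
g_k - g_(k-1) is at most K_(n-k) * G_eps (eps_k), and g_1 minus its mean is at
most K_(n-1) * G_X1 (X_1) ([observable_dev]).

A centred variable dominated by a Z with E Z^k <= k!/2 V M^(k-2) has
E exp (s xi) <= exp (s^2 V / (2 (1 - |s| M))): bound exp x - 1 - x by its Taylor
series in Z and sum a geometric series ([bernstein_mgf]).  Applied to the
increment conditionally on the past and chained backwards, this multiplies one
such factor per step ([history_mgf]).  Conditioning takes the form of Fubini's
theorem for the law of the pair (past of the chain, next innovation), which is a
product law because the past is a measurable function of X_1 and of the earlier
innovations ([history_indep], a pi-lambda argument).  All integrands are
measurable because a Lipschitz function on a separable metric space is an
infimum of countably many cones f z + d (., z) ([measurable_lipschitz_tuple]);
the product sigma-algebra of the Borel sets thus suffices.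

The deviation inequality is Markov's inequality for the optimal exponent
([bernstein_tail]). *)

(** * Measurability of Lipschitz functions on separable metric spaces *)

Section separable_metric.
Context {R : realType} {S : completeMetricType R}.

Lemma separable_dense_seq : separable_space S ->
  exists u : nat -> S, forall x e, 0 < e -> exists i, mdist x (u i) < e.
Proof.
case=> D cD dD; have /pcard_surjP[u uD] := cD.
exists u => x e e0.
have [y [xy Dy]] : ((ball x e)^° `&` D) !=set0.
  apply: dD; last exact: open_interior.
  by exists x; apply: nbhsx_ballx.
have [i _ uiy] := uD _ Dy; exists i; rewrite uiy.
by have /= := interior_subset xy; rewrite ballEmdist.
Qed.

Lemma ler_dist_mdist (x y z : S) : `|mdist x z - mdist y z| <= mdist x y.
Proof.
rewrite ler_norml lerBlDr metric_triangle andbT lerNl opprB lerBlDr.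
by rewrite [X in _ <= X + _]metric_sym metric_triangle.
Qed.

Lemma measurable_mdist (z : S) :
  measurable_fun [set: borel S] (fun x : borel S => mdist (x : S) z : R).
Proof.
apply: (measurability _ (RGenInftyO.measurableE R)) => _ [_ [r ->] <-].
rewrite setTI; apply: sub_sigma_algebra => /=.
rewrite openE => x /=; rewrite in_itv/= => xr.
apply/nbhs_ballP; exists (r - mdist x z) => /=; first by rewrite subr_gt0.
move=> y; rewrite ballEmdist/= in_itv/= => xy.
have := ler_dist_mdist y x z; rewrite ler_norml metric_sym; lra.
Qed.

End separable_metric.

Section measurable_lipschitz.
Context {R : realType}.

(** [phi] is the pointwise infimum of the [c j], so [phi < r] is the union of the
[c j < r]. *)
Lemma measurable_fun_inf_family d (T : measurableType d) (phi : T -> R)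
    (c : nat -> T -> R) :
  (forall j, measurable_fun setT (c j)) -> (forall j w, phi w <= c j w) ->
  (forall w e, 0 < e -> exists j, c j w < phi w + e) ->
  measurable_fun setT phi.
Proof.
move=> mc phic cphi.
apply: (measurability _ (RGenInftyO.measurableE R)) => _ [_ [r ->] <-].
rewrite setTI (_ : _ @^-1` _ = \bigcup_j (c j @^-1` `]-oo, r[)).
  apply: bigcup_measurable => j _; rewrite -[_ @^-1` _]setTI.
  by apply: mc => //; exact: measurable_itv.
apply/seteqP; split => w /=; rewrite in_itv/=.
- move=> wr; have [|j jw] := cphi w (r - phi w); first by rewrite subr_gt0.
  by exists j => //=; rewrite in_itv/=; move: jw; rewrite addrC subrK.
- by move=> [j _]/=; rewrite in_itv/=; exact/le_lt_trans/phic.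
Qed.

(** McShane's formula over a countable dense set: [g x] is the infimum over the
tuples [z] of dense points of [g z] plus the weighted distance from [x] to [z].
Each of these functions of [x] only involves distances to fixed points, which
are Borel in each coordinate; no Borel structure on the product is involved. *)
Lemma measurable_lipschitz_tuple (S : completeMetricType R) d
    (T : measurableType d) n (Z : 'I_n -> T -> borel S) (a : 'I_n -> R)
    (g : n.-tuple S -> R) :
  separable_space S ->
  (forall i, measurable_fun setT (Z i)) -> (forall i, 0 <= a i) ->
  (forall x x' : n.-tuple S,
     `|g x - g x'| <= \sum_(i < n) a i * mdist (tnth x i) (tnth x' i)) ->
  measurable_fun setT (fun w => g [tuple (Z i w : S) | i < n]).
Proof.
move=> /separable_dense_seq[u du] mZ a0 lg.
pose pt (j : nat) : n.-tuple S :=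
  [tuple u (tnth (odflt [tuple 0%N | _ < n] (unpickle j)) i) | i < n].
pose c j w := g (pt j) + \sum_(i < n) a i * mdist (Z i w : S) (tnth (pt j) i).
apply: (@measurable_fun_inf_family _ _ _ c).
- move=> j; apply: measurable_funD => //; apply: measurable_sum => i.
  apply: measurable_funM => //.
  by apply: (measurableT_comp (measurable_mdist _)) (mZ i).
- move=> j w; rewrite /c -lerBlDl.
  apply: le_trans (ler_norm _) _; apply: le_trans (lg _ _) _.
  by apply: ler_sum => i _; rewrite tnth_mktuple.
- move=> w e e0.
  pose A := \sum_(i < n) a i.
  have A0 : 0 <= A by apply: sumr_ge0.
  have /choice[k kP] (i : 'I_n) :
      exists j, mdist (Z i w : S) (u j) < e / (2 * A + 1) / 2.
    by apply: du; rewrite !divr_gt0//; lra.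
  (* The distance to the chosen dense tuple enters c twice, through g and as the
     added term, hence the target e / 2 for it; the + 1 covers A = 0. *)
  exists (pickle [tuple k i | i < n]).
  have := lg (pt (pickle [tuple k i | i < n])) [tuple Z i w | i < n].
  rewrite /c ler_norml => /andP[_ +].
  set s1 := \sum_i _; set s2 := \sum_i _.
  have -> : s1 = s2.
    by apply: eq_bigr => i _; rewrite metric_sym tnth_mktuple.
  have : s2 <= A * (e / (2 * A + 1) / 2).
    rewrite /s2 /A mulr_suml; apply: ler_sum => i _; apply: ler_wpM2l => //.
    by rewrite /pt pickleK /= !tnth_mktuple ltW.
  have -> : A * (e / (2 * A + 1) / 2) = e / 2 * (A / (2 * A + 1)) by ring.
  have : e / 2 * (A / (2 * A + 1)) < e / 2.
    rewrite gtr_pMr ?divr_gt0// ltr_pdivrMr; lra.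
  lra.
Qed.

Lemma measurable_lipschitz (S : completeMetricType R) (a : R)
    (g : S -> R) :
  separable_space S -> 0 <= a ->
  (forall x x', `|g x - g x'| <= a * mdist x x') ->
  measurable_fun setT (g : borel S -> R).
Proof.
move=> sepS a0 lg.
pose G (x : 1.-tuple S) := g (tnth x ord0).
rewrite (_ : g = fun w => G [tuple w | _ < 1]); last first.
  by apply/funext => w; rewrite /G tnth_mktuple.
apply: (@measurable_lipschitz_tuple S _ (borel S) 1 (fun _ => id)
  (fun _ => a)) => // x x'.
by rewrite big_ord1; apply: lg.
Qed.

(** The distance is Lipschitz in both arguments, hence measurable for the product
sigma-algebra. *)
Lemma measurable_mdist2 (S : completeMetricType R) d (T : measurableType d)
    (f g : T -> borel S) : separable_space S ->
  measurable_fun setT f -> measurable_fun setT g ->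
  measurable_fun setT (fun w => mdist (f w : S) (g w : S) : R).
Proof.
move=> sepS mf mg.
pose G (x : 2.-tuple S) := mdist (tnth x ord0) (tnth x ord_max).
pose Z (i : 'I_2) : T -> borel S := if i == ord0 then f else g.
rewrite (_ : (fun w => _) = fun w => G [tuple (Z i w : S) | i < 2]); last first.
  by apply/funext => w; rewrite /G !tnth_mktuple.
apply: (@measurable_lipschitz_tuple S _ T 2 Z (fun _ => 1)) => // [i|x x'].
  by rewrite /Z; case: ifP.
rewrite big_ord_recl big_ord1 !mul1r.
rewrite (_ : lift ord0 ord0 = ord_max :> 'I_2); last exact: val_inj.
set p := tnth x _; set q := tnth x _; set p' := tnth x' _; set q' := tnth x' _.
have := ler_dist_mdist p p' q; have := ler_dist_mdist q q' p'.
by rewrite /G !ler_norml [mdist q p']metric_sym [mdist q' p']metric_sym; lra.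
Qed.

End measurable_lipschitz.

(** * Bernstein's bound on the moment generating function *)

Section bernstein_mgf.
Context {R : realType}.

(** The remainder is taken in [\bar R] so that it can be integrated term by
term without first knowing that [expR z] is integrable. *)
Lemma expR_sub_le_series (x z : R) : `|x| <= z ->
  ((expR x - 1 - x)%:E <= \sum_(k <oo) (z ^+ k.+2 / k.+2`!%:R)%:E)%E.
Proof.
move=> xz; have z0 : 0 <= z by apply: le_trans xz.
have term0 k : (0 <= (z ^+ k.+2 / k.+2`!%:R)%:E)%E.
  by rewrite lee_fin divr_ge0 ?exprn_ge0.
have cvgE : (series (exp_coeff x) n.+2 - 1 - x)%:E @[n --> \oo]
              --> (expR x - 1 - x)%:E.
  apply: cvg_EFin; first exact: nearW.
  apply: cvgB; last exact: cvg_cst.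
  apply: cvgB; last exact: cvg_cst.
  rewrite (_ : (fun n => _) = fun n => series (exp_coeff x) (n + 2)%N); last first.
    by apply/funext => n; rewrite addn2.
  by rewrite (cvg_shiftn 2 (series (exp_coeff x))); exact: is_cvg_series_exp_coeff.
rewrite -(cvg_lim _ cvgE)//; apply: lime_le.
  by apply/cvg_ex; eexists; exact: cvgE.
apply: nearW => n.
apply: le_trans (nneseries_lim_ge n _) => //.
rewrite sumEFin lee_fin.
rewrite seriesEnat/= 2?big_nat_recl// /exp_coeff/= expr0 expr1 !divr1.
rewrite (_ : 1 + (x + _) - 1 - x =
    \sum_(0 <= i < n) (x ^+ i.+2 / i.+2`!%:R)); last by ring.
apply: ler_sum => i _; rewrite ler_wpM2r ?invr_ge0//.
by apply: le_trans (ler_norm _) _; rewrite normrX; apply: lerXn2r; rewrite ?nnegrE.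
Qed.

(** The linear term of [expR (s * xi)] integrates to 0.  The remainder is at most
the sum over k >= 2 of |s|^k E Z^k / k!, which the moment condition bounds by the
geometric series s^2 V / 2 * sum_k (|s| M)^k; conclude with 1 + B <= exp B. *)
Lemma bernstein_mgf d (T : measurableType d) (mu : probability T R)
    (xi Z : T -> R) (V M s : R) :
  measurable_fun setT Z -> (forall w, `|xi w| <= Z w) ->
  mu.-integrable setT (EFin \o xi) -> (\int[mu]_w (xi w)%:E = 0)%E ->
  0 <= V -> 0 <= M ->
  (forall k, (2 <= k)%N ->
     (\int[mu]_w (Z w ^+ k)%:E <= (k`!%:R / 2 * V * M ^+ (k - 2))%:E)%E) ->
  `|s| * M < 1 ->
  (\int[mu]_w (expR (s * xi w))%:E
     <= (expR (s ^+ 2 * V / (2 * (1 - `|s| * M))))%:E)%E.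
Proof.
move=> mZ xiZ ixi xi0 V0 M0 momZ sM1.
have mxi : measurable_fun setT xi by exact/measurable_EFinP/(measurable_int mu).
have Z0 w : 0 <= Z w by apply: le_trans (xiZ w).
pose q w := expR (s * xi w) - 1 - s * xi w.
have q0 w : 0 <= q w.
  by rewrite /q; have := expR_ge1Dx (s * xi w); lra.
have msxi : measurable_fun setT (fun w => s * xi w) by apply: measurable_funM.
have mq : measurable_fun setT q.
  by do 2 apply: measurable_funB => //; exact: measurableT_comp.
pose B := s ^+ 2 * V / (2 * (1 - `|s| * M)).
have qB : (\int[mu]_w (q w)%:E <= B%:E)%E.
  pose c k w := ((`|s| * Z w) ^+ k.+2 / k.+2`!%:R)%:E.
  have mc k : measurable_fun setT (c k).
    apply/measurable_EFinP; apply: measurable_funM => //.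
    by apply: measurable_funX; apply: measurable_funM.
  have c0 k w : (0 <= c k w)%E.
    by rewrite lee_fin divr_ge0// exprn_ge0// mulr_ge0.
  apply: (@le_trans _ _ (\int[mu]_w \sum_(k <oo) c k w)%E).
    apply: ge0_le_integral => //.
    - by move=> w _; rewrite lee_fin.
    - exact/measurable_EFinP.
    - by apply: ge0_emeasurable_sum.
    - by move=> w _; apply: expR_sub_le_series; rewrite normrM ler_wpM2l.
  rewrite integral_nneseries//.
  have cB k : (\int[mu]_w c k w <= (s ^+ 2 * V / 2 * (`|s| * M) ^+ k)%:E)%E.
    rewrite (eq_integral (fun w =>
      (`|s| ^+ k.+2 / k.+2`!%:R)%:E * (Z w ^+ k.+2)%:E)%E); last first.
      by move=> w _; rewrite /c -EFinM exprMn mulrAC.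
    rewrite ge0_integralZl_EFin//.
    - apply: le_trans (lee_wpmul2l _ (momZ k.+2 _)) _ => //.
      rewrite -EFinM lee_fin subSS subSS subn0.
      rewrite (_ : `|s| ^+ k.+2 = s ^+ 2 * `|s| ^+ k); last first.
        by rewrite -(real_normK (num_real s)) -exprD.
      rewrite exprMn.
      by rewrite le_eqVlt; apply/orP; left; apply/eqP; field;
         rewrite pnatr_eq0 -lt0n fact_gt0.
    - by move=> w _; rewrite lee_fin exprn_ge0.
    - by apply/measurable_EFinP; apply: measurable_funX.
  apply: le_trans (lee_nneseries _ _) _.
  - by move=> k _ _; apply: integral_ge0.
  - by move=> k _; apply: cB.
  have sV0 : 0 <= s ^+ 2 * V / 2.
    by apply: mulr_ge0; rewrite ?invr_ge0//; apply: mulr_ge0; rewrite ?sqr_ge0.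
  apply: lime_le.
    apply: is_cvg_ereal_nneg_natsum => k _; rewrite lee_fin.
    by apply: mulr_ge0 => //; apply: exprn_ge0; exact: mulr_ge0.
  apply: nearW => n; rewrite sumEFin lee_fin -mulr_sumr big_mkord.
  rewrite /B (_ : _ / (2 * _) = s ^+ 2 * V / 2 * (1 - `|s| * M)^-1); last first.
    by rewrite invfM mulrA.
  rewrite ler_wpM2l// -div1r ler_pdivlMr ?subr_gt0//.
  rewrite mulrC -opprB mulNr -subrX1 opprB lerBlDr lerDl exprn_ge0// mulr_ge0//.
have iq : mu.-integrable setT (EFin \o q).
  apply/integrableP; split; first exact/measurable_EFinP.
  under eq_integral do rewrite /= ger0_norm//.
  exact: le_lt_trans qB (ltry _).
have isxi : mu.-integrable setT (fun w => s%:E * (xi w)%:E)%E by exact: integrableZl.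
have i1 : mu.-integrable setT (fun w => (1%E + s%:E * (xi w)%:E))%E.
  by apply: integrableD => //; exact: finite_measure_integrable_cst.
rewrite (eq_integral (fun w => (q w)%:E + (1%E + s%:E * (xi w)%:E))%E); last first.
  by move=> w _; rewrite -EFinM -!EFinD /q; congr EFin; ring.
rewrite integralD// integralD//; last exact: finite_measure_integrable_cst.
rewrite integralZl// xi0 mule0 adde0 integral_cst// mul1e.
rewrite [X in (_ + X)%E](@probability_setT _ _ _ mu).
apply: le_trans (leeD2r _ qB) _.
by rewrite -EFinD lee_fin addrC expR_ge1Dx.
Qed.

End bernstein_mgf.

(** * Optimisation of the exponential Markov bound *)

Section bernstein_tail.
Context {R : realType}.
Implicit Types V Delta x t p : R.

(** [sqrt (1 + 2 u) <= 1 + u] with [u = x * Delta / V]. *)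
Lemma bernstein_denom_le V Delta x : 0 <= V -> 0 < Delta -> 0 < x ->
  0 < bernstein_denom V Delta x <= 2 * (V + x * Delta).
Proof.
move=> V0 D0 x0; have xD := mulr_gt0 x0 D0.
rewrite /bernstein_denom; set r := Num.sqrt _.
have r0 : 0 <= r by exact: sqrtr_ge0.
have r1 : 0 <= V * (1 + r) by rewrite mulr_ge0// addr_ge0.
apply/andP; split; first by lra.
move: V0; rewrite le_eqVlt => /predU1P[V0|V0]; first by rewrite -V0 in xD *; lra.
have y0 : 0 < x * Delta / V by exact: divr_gt0.
have rle : r <= 1 + x * Delta / V.
  rewrite -(ler_pXn2r (ltn0Sn 1)) ?nnegrE//; last by lra.
  rewrite sqr_sqrtr -!mulrA; last by rewrite !mulrA -!mulrA in y0 *; lra.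
  by have := sqr_ge0 (x * Delta / V); rewrite -!mulrA; nra.
have : V * r <= V * (1 + x * Delta / V) by rewrite ler_pM2l.
rewrite (_ : V * (1 + x * Delta / V) = V + x * Delta); last first.
  by field; rewrite gt_eqF.
lra.
Qed.

(** The minimiser of the exponent: with [r = sqrt (1 + 2 x Delta / V)] it is
[t = (1 - 1 / r) / Delta], for which [1 - t * Delta = 1 / r], and both sides equal
[- V * (r - 1) ^+ 2 / (2 * Delta ^+ 2)]. *)
Lemma bernstein_conjugate V Delta x : 0 < V -> 0 < Delta -> 0 < x ->
  exists2 t, 0 < t < Delta^-1 &
    t ^+ 2 * V / (2 * (1 - t * Delta)) - t * x =
    - (x ^+ 2 / bernstein_denom V Delta x).
Proof.
move=> V0 D0 x0.
rewrite /bernstein_denom; set r := Num.sqrt _.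
have a0 : 0 < 2 * x * Delta / V by rewrite divr_gt0 ?mulr_gt0.
have r2 : r ^+ 2 = 1 + 2 * x * Delta / V by rewrite sqr_sqrtr//; lra.
have r0 : 0 <= r by exact: sqrtr_ge0.
have r1 : 1 < r by nra.
have xE : x = V * (r ^+ 2 - 1) / (2 * Delta).
  by rewrite r2; field; rewrite !gt_eqF.
exists ((r - 1) / (r * Delta)).
  rewrite divr_gt0 ?mulr_gt0 ?subr_gt0//=; last by lra.
  rewrite invfM mulrA gtr_pMl ?invr_gt0// ltr_pdivrMr; lra.
rewrite xE; field; do ?[apply/andP; split]; rewrite ?gt_eqF//; nra.
Qed.

(** For [V = 0] there is no minimiser: the exponent [- t * x] decreases up to the
excluded end point [t = Delta^-1], whose value [- x / Delta] is reached as a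
limit. *)
Lemma bernstein_tail V Delta x p : 0 <= V -> 0 < Delta -> 0 < x ->
  (forall t, 0 < t < Delta^-1 ->
     p <= expR (t ^+ 2 * V / (2 * (1 - t * Delta))) * expR (- (t * x))) ->
  p <= expR (- (x ^+ 2 / bernstein_denom V Delta x)).
Proof.
move=> V0 D0 x0 H; move: V0; rewrite le_eqVlt => /predU1P[V0|V0].
- have -> : x ^+ 2 / bernstein_denom V Delta x = x / Delta.
    by rewrite /bernstein_denom -V0 mul0r add0r; field; rewrite !gt_eqF.
  rewrite leNgt; apply/negP => Hp.
  have p0 : 0 < p by apply: lt_trans Hp; exact: expR_gt0.
  (* If p > exp (- x / Delta), some t < 1 / Delta has t * x > - ln p. *)
  pose a := Num.max 0 (- ln p / x).
  have aD : a < Delta^-1.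
    rewrite /a gt_max invr_gt0 D0/= ltr_pdivrMr// mulrC ltrNl.
    by rewrite -(expRK (- _)) ltr_ln ?posrE ?expR_gt0.
  pose t := (a + Delta^-1) / 2.
  have tD : t < Delta^-1 by rewrite /t; lra.
  have at_ : a < t by rewrite /t; lra.
  have t0 : 0 < t by apply: le_lt_trans at_; rewrite /a le_max lexx.
  have := H t; rewrite t0 tD => /(_ isT).
  rewrite -V0 mulr0 mul0r expR0 mul1r leNgt => /negP; apply.
  rewrite -[ltRHS]lnK ?posrE// ltr_expR ltrNl -ltr_pdivrMr//.
  by apply: le_lt_trans at_; rewrite /a le_max lexx orbT.
- have [t tD <-] := bernstein_conjugate V0 D0 x0.
  by rewrite expRB -expRN; exact: H.
Qed.

End bernstein_tail.

(** * Lipschitz functions of one random point *)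

Lemma measurable_fun_expe d (T : measurableType d) (R : realType)
    (f : T -> \bar R) k :
  measurable_fun setT f -> measurable_fun setT (fun x => (f x ^+ k)%E).
Proof.
move=> mf; elim: k => [|k IH].
  by rewrite [X in measurable_fun _ X](_ : _ = cst 1%E).
rewrite (_ : (fun x => _) = fun x => (f x * f x ^+ k)%E); last first.
  by apply/funext => x; rewrite expeS.
exact: emeasurable_funM.
Qed.

Section lipschitz_observable.
Context {R : realType} {S : completeMetricType R}.
Variables (nu : probability (borel S) R) (c : R).
Hypotheses (sepS : separable_space S) (c0 : 0 <= c).
Implicit Types (phi : S -> R) (a s : R) (y : S).

Let G : borel S -> \bar R := mean_dist c nu.

Lemma measurable_scaled_mdist y :
  measurable_fun setT (fun y' : borel S => (c * mdist y (y' : S))%:E).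
Proof.
apply/measurable_EFinP; apply: measurable_funM => //.
by apply: measurable_mdist2.
Qed.

Lemma mean_dist_ge0 y : (0 <= G y)%E.
Proof.
by apply: integral_ge0 => y' _; rewrite lee_fin mulr_ge0 ?mdist_ge0.
Qed.

Lemma measurable_mean_dist : measurable_fun setT G.
Proof.
pose f (z : borel S * borel S) := (c * mdist (z.1 : S) (z.2 : S))%:E.
apply: (measurable_fun_fubini_tonelli_F f).
- apply/measurable_EFinP; apply: measurable_funM => //.
  by apply: measurable_mdist2.
- by move=> z; rewrite lee_fin mulr_ge0 ?mdist_ge0.
Qed.

Lemma mean_dist_triangle y y0 : (G y <= (c * mdist y y0)%:E + G y0)%E.
Proof.
apply: (@le_trans _ _
  (\int[nu]_y' ((c * mdist y y0)%:E + (c * mdist y0 y')%:E))%E).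
  apply: ge0_le_integral => //.
  - by move=> y' _; rewrite lee_fin mulr_ge0 ?mdist_ge0.
  - exact: measurable_scaled_mdist.
  - by apply: emeasurable_funD => //; exact: measurable_scaled_mdist.
  - by move=> y' _; rewrite -EFinD lee_fin -mulrDr ler_wpM2l// metric_triangle.
rewrite ge0_integralD//.
- rewrite integral_cst// [X in (_ * X)%E](@probability_setT _ _ _ nu) mule1.
  exact: lexx.
- by move=> y' _; rewrite lee_fin mulr_ge0 ?mdist_ge0.
- by move=> y' _; rewrite lee_fin mulr_ge0 ?mdist_ge0.
- exact: measurable_scaled_mdist.
Qed.

(** By the triangle inequality [G] is finite everywhere as soon as it is finite
at one point, and it is if its square is integrable. *)
Lemma mean_dist_lty : (\int[nu]_y G y ^+ 2 < +oo)%E -> forall y, (G y < +oo)%E.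
Proof.
move=> G2 y.
have [y0 Gy0] : exists y0, (G y0 < +oo)%E.
  apply: contrapT => /forallNP GN; move: G2; apply/negP; rewrite -leNgt.
  rewrite (eq_integral (cst +oo%E)); last first.
    move=> x _; rewrite (_ : G x = +oo%E).
      by rewrite !expeS expe0 mule1 mulyy.
    by apply/eqP; rewrite -leye_eq leNgt; apply/negP; exact: GN.
  by rewrite integral_cst// [X in (_ * X)%E](@probability_setT _ _ _ nu) mule1.
by apply: le_lt_trans (mean_dist_triangle y y0) _; rewrite lte_add_pinfty// ltry.
Qed.

Hypothesis Glty : forall y, (G y < +oo)%E.

Let Gfin y : G y \is a fin_num.
Proof. by rewrite ge0_fin_numE// mean_dist_ge0. Qed.

Lemma integrable_scaled_mdist y :
  nu.-integrable setT (fun y' : borel S => (c * mdist y (y' : S))%:E).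
Proof.
apply/integrableP; split; first exact: measurable_scaled_mdist.
under eq_integral do rewrite gee0_abs ?lee_fin ?mulr_ge0 ?mdist_ge0//.
exact: Glty.
Qed.

Lemma integrable_mean_dist : nu.-integrable setT (EFin \o fine \o G).
Proof.
have iy := integrable_scaled_mdist point.
have : nu.-integrable setT
    (fun y : borel S => (c * mdist point (y : S))%:E + (fine (G point))%:E)%E.
  by apply: integrableD => //; exact: finite_measure_integrable_cst.
apply: le_integrable => //.
  apply/measurable_EFinP; apply: measurableT_comp => //.
  exact: measurable_mean_dist.
move=> y _ /=; rewrite lee_fin ger0_norm ?fine_ge0 ?mean_dist_ge0//.
apply: le_trans (ler_norm _); rewrite -lee_fin EFinD !fineK// metric_sym.
exact: mean_dist_triangle.
Qed.

(** The point is the initial state, with [c = 1], or an innovation, whose effect on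
the state is Lipschitz with [c = C]. *)
Section observable.
Variables (phi : S -> R) (a : R).
Hypotheses (a0 : 0 <= a)
  (lphi : forall y y', `|phi y - phi y'| <= a * (c * mdist y y')).

Lemma measurable_observable : measurable_fun setT (phi : borel S -> R).
Proof.
apply: (@measurable_lipschitz _ _ (a * c)) => //; first exact: mulr_ge0.
by move=> y y'; rewrite -mulrA.
Qed.

Lemma integrable_observable : nu.-integrable setT (EFin \o (phi : borel S -> R)).
Proof.
have iy := integrable_scaled_mdist (point : S).
have : nu.-integrable setT
    (fun y : borel S => (`|phi point|)%:E + a%:E * (c * mdist point (y : S))%:E)%E.
  apply: integrableD => //; first exact: finite_measure_integrable_cst.
  exact: integrableZl.
apply: le_integrable => //.
  by apply/measurable_EFinP; exact: measurable_observable.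
move=> y _ /=; rewrite lee_fin [leRHS]ger0_norm; last first.
  by rewrite addr_ge0// mulr_ge0// mulr_ge0// mdist_ge0.
rewrite -lerBlDl; apply: le_trans (lphi _ _).
by rewrite distrC; apply: le_trans (lerB_dist _ _) _.
Qed.

(** [phi y] minus its mean is the mean of [phi y - phi y'] over [y']. *)
Lemma observable_dev y : `|phi y - \int[nu]_y' phi y'| <= a * fine (G y).
Proof.
have cstE : phi y = \int[nu]_(y' in setT) phi y.
  by rewrite Rintegral_cst// [X in fine X](@probability_setT _ _ _ nu) mulr1.
rewrite {1}cstE -RintegralB//; last 2 first.
- exact: finite_measure_integrable_cst.
- exact: integrable_observable.
have id : nu.-integrable setT (EFin \o (fun y' : borel S => phi y - phi y')).
  under [_ \o _]eq_fun do rewrite /= EFinB.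
  apply: integrableB => //; first exact: finite_measure_integrable_cst.
  exact: integrable_observable.
apply: le_trans (le_normr_Rintegral _ id) _ => //.
rewrite /G /mean_dist
  -/(Rintegral nu setT (fun x' : borel S => c * mdist y (x' : S))).
rewrite -RintegralZl//; last exact: integrable_scaled_mdist.
apply: le_Rintegral => //.
- exact: (integrable_norm id).
- by under [_ \o _]eq_fun do rewrite /= EFinM; apply: integrableZl => //;
    exact: integrable_scaled_mdist.
Qed.

Lemma observable_mgf (V M s : R) : 0 <= V -> 0 <= M ->
  (forall k, (2 <= k)%N ->
     (\int[nu]_y G y ^+ k <= (k`!%:R / 2 * V * M ^+ (k - 2))%:E)%E) ->
  `|s| * (a * M) < 1 ->
  (\int[nu]_y (expR (s * (phi y - \int[nu]_y' phi y')))%:E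
     <= (expR (s ^+ 2 * (V * a ^+ 2) / (2 * (1 - `|s| * (a * M)))))%:E)%E.
Proof.
move=> V0 M0 momG saM; set m := \int[nu]_y' phi y'.
apply: (@bernstein_mgf _ _ (borel S) nu (fun y : borel S => phi y - m)
  (fun y : borel S => a * fine (G y))).
- apply: measurable_funM => //; apply: measurableT_comp => //.
  exact: measurable_mean_dist.
- by move=> y; exact: observable_dev.
- under [_ \o _]eq_fun do rewrite /= EFinB.
  apply: integrableB => //; first exact: integrable_observable.
  exact: finite_measure_integrable_cst.
- rewrite integralB_EFin//; last 2 first.
  + exact: integrable_observable.
  + exact: finite_measure_integrable_cst.
  rewrite integral_cst// [X in (_ * X)%E](@probability_setT _ _ _ nu) mule1.
  rewrite /m /Rintegral fineK ?subee//; apply: integrable_fin_num => //;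
  exact: integrable_observable.
- by rewrite mulr_ge0// sqr_ge0.
- exact: mulr_ge0.
- move=> k k2.
  rewrite (eq_integral (fun y : borel S => (a ^+ k)%:E * G y ^+ k)%E); last first.
    by move=> y _; rewrite exprMn EFinM [X in (_ * X = _)%E]EFin_expe fineK.
  rewrite ge0_integralZl_EFin//; last 3 first.
  + by move=> y _; rewrite expe_ge0// mean_dist_ge0.
  + by apply: measurable_fun_expe; exact: measurable_mean_dist.
  + exact: exprn_ge0.
  apply: le_trans (lee_wpmul2l _ (momG _ k2)) _.
    by rewrite lee_fin exprn_ge0.
  rewrite -EFinM lee_fin le_eqVlt; apply/orP; left; apply/eqP.
  by rewrite -{1}(subnK k2) exprD exprMn; ring.
- exact: saM.
Qed.

End observable.

End lipschitz_observable.

(** * Integrals over independent pairs *)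

Lemma integrable_distribution d d' (Omega : measurableType d)
    (T : measurableType d') (R : realType) (P : probability Omega R)
    (X : {RV P >-> T}) (f : T -> R) :
  (distribution P X).-integrable setT (EFin \o f) ->
  P.-integrable setT (fun w => (f (X w))%:E).
Proof.
move=> /integrableP[mf flty]; apply/integrableP; split.
  exact: measurableT_comp mf _.
rewrite ge0_integral_distribution// in flty.
exact: measurableT_comp.
Qed.

Section independent_integral.
Context d d1 d2 {Omega : measurableType d} {T1 : measurableType d1}
  {T2 : measurableType d2} {R : realType}.
Variables (P : probability Omega R) (U : {RV P >-> T1}) (E : {RV P >-> T2})
  (nu : probability T2 R).
Hypothesis indUE : forall A B, measurable A -> measurable B ->
  P (U @^-1` A `&` E @^-1` B) = (P (U @^-1` A) * nu B)%E.

Let mu := distribution P U.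

Let mUE : measurable_fun setT (fun w => (U w, E w)).
Proof. exact: measurable_fun_pair. Qed.

Lemma indep_ge0_integral (f : T1 * T2 -> \bar R) :
  measurable_fun setT f -> (forall z, (0 <= f z)%E) ->
  (\int[P]_w f (U w, E w) = \int[mu]_u \int[nu]_y f (u, y))%E.
Proof.
move=> mf f0.
pose UE : {RV P >-> (T1 * T2)%type} := HB.pack (fun w => (U w, E w))
  (isMeasurableFun.Build _ _ _ _ _ mUE).
transitivity (\int[distribution P UE]_z f z)%E.
  by rewrite ge0_integral_distribution.
rewrite -(fubini_tonelli1 f)//; apply: eq_measure_integral => A mA _.
exact/esym/product_measure_unique.
Qed.

(** The domination of [h - g] by a function of the second variable alone makes [h]
integrable for the product law whenever [g] is for the first marginal. *)
Lemma indep_integral (h : T1 * T2 -> R) (g : T1 -> R) (Z : T2 -> R) :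
  measurable_fun setT h -> measurable_fun setT g ->
  nu.-integrable setT (EFin \o Z) ->
  (forall u y, `|h (u, y) - g u| <= Z y) ->
  (forall u, (\int[nu]_y (h (u, y))%:E = (g u)%:E)%E) ->
  P.-integrable setT (EFin \o g \o U) ->
  P.-integrable setT (fun w => (h (U w, E w))%:E) /\
  (\int[P]_w (h (U w, E w))%:E = \int[P]_w (g (U w))%:E)%E.
Proof.
move=> mh mg iZ hgZ hg ig.
have mEh : measurable_fun setT (EFin \o h) by exact/measurable_EFinP.
have ig' : mu.-integrable setT (EFin \o g).
  by apply: integrable_pushforward => //; exact/measurable_EFinP.
have hlty : (\int[mu]_u \int[nu]_y `|(h (u, y))%:E| < +oo)%E.
  have Z0 y : 0 <= Z y by apply: le_trans (hgZ point y).
  have [mZ Zlty] := integrableP _ _ _ iZ.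
  apply: (@le_lt_trans _ _ (\int[mu]_u (`|(g u)%:E| + \int[nu]_y `|(Z y)%:E|))%E).
    apply: ge0_le_integral => //.
    - by move=> u _; exact: integral_ge0.
    - apply: (measurable_fun_fubini_tonelli_F (fun z => `|(h z)%:E|)%E) => //.
      exact: measurableT_comp.
    - apply: emeasurable_funD => //; apply: measurableT_comp => //.
      exact/measurable_EFinP.
    - move=> u _.
      rewrite -[X in (X + _)%E]mule1 -(@probability_setT _ _ _ nu) -integral_cst//.
      rewrite -ge0_integralD//; [|by move=> y _ /=|exact: measurableT_comp].
      apply: ge0_le_integral => //.
      + apply: measurableT_comp => //; apply/measurable_EFinP.
        exact: measurableT_comp.
      + by apply: emeasurable_funD => //; exact: measurableT_comp.
      + move=> y _; rewrite -EFinD lee_fin (ger0_norm (Z0 y)) -lerBlDl.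
        by apply: le_trans (hgZ u y); exact: lerB_dist.
  rewrite ge0_integralD//; last 2 first.
  + by apply: measurableT_comp => //; exact/measurable_EFinP.
  + by move=> u _; exact: integral_ge0.
  rewrite integral_cst; last by [].
  rewrite [X in (_ * X)%E](@probability_setT _ _ _ mu) mule1.
  by rewrite lte_add_pinfty//; have /integrableP[] := ig'.
have iP : P.-integrable setT (fun w => (h (U w, E w))%:E).
  apply/integrableP; split; first exact: measurableT_comp mEh mUE.
  by rewrite (indep_ge0_integral (f := fun z => `|(h z)%:E|%E))//;
    exact: measurableT_comp.
split=> //.
pose UE : {RV P >-> (T1 * T2)%type} := HB.pack (fun w => (U w, E w))
  (isMeasurableFun.Build _ _ _ _ _ mUE).
have ih : (mu \x nu)%E.-integrable setT (EFin \o h) by exact/integrable12ltyP.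
transitivity (\int[distribution P UE]_z (EFin \o h) z)%E.
  by rewrite integral_distribution.
transitivity (\int[mu \x nu]_z (EFin \o h) z)%E.
  apply: eq_measure_integral => A mA _.
  exact/esym/product_measure_unique.
rewrite -integral12_prod_meas1// /fubini_F.
under eq_integral do rewrite /= hg.
by rewrite integral_distribution//; exact/measurable_EFinP.
Qed.

End independent_integral.

(** * Independence of the past and the next innovation *)

(** The states X_(k+1), .., X_1, newest first, so that one step of the chain is a
cons. *)
Fixpoint history (Omega S : Type) (X : nat -> Omega -> S) (k : nat) (w : Omega) :
    k.+1.-tuple S :=
  match k with
  | 0 => [tuple X 1%N w]
  | j.+1 => [tuple of X j.+2 w :: history X j w]
  end.

Lemma thead_history (Omega S : Type) (X : nat -> Omega -> S) k w :
  thead (history X k w) = X k.+1 w.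
Proof. by case: k. Qed.

Section history_independence.
Context {R : realType} d dX dY {Omega : measurableType d}
  {TX : measurableType dX} {TY : measurableType dY} (P : probability Omega R).
Variables (eps : nat -> {RV P >-> TY}) (X : nat -> {RV P >-> TX})
  (F : TX * TY -> TX).
Hypotheses (ind_eps : mutually_independent [set i | (1 <= i)%N] eps)
  (indX1 : independent_of_family (X 1%N) [set i | (2 <= i)%N] eps)
  (mF : measurable_fun setT F)
  (chain : forall k, (2 <= k)%N -> forall w, X k w = F (X k.-1 w, eps k w)).
Implicit Types (A : set TX) (B : nat -> set TY) (k : nat).

(** The innovations eps_2, .., eps_(k+1) are those that drive X_2, .., X_(k+1). *)
Let box k B := \bigcap_(i in [set` iota 2 k]) (eps i @^-1` B i).

Let iota2S k : iota 2 k.+1 = rcons (iota 2 k) k.+2.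
Proof. by rewrite -[in LHS](addn1 k) iotaD add2n cats1. Qed.

(** A pi-system generating the sigma-algebra of X_1, eps_2, .., eps_(k+1). *)
Let past k : set (set Omega) := [set G | exists A B,
  [/\ measurable A, forall i, measurable (B i) & G = X 1%N @^-1` A `&` box k B]].

Let P_box A B k : measurable A -> (forall i, measurable (B i)) ->
  P (X 1%N @^-1` A `&` box k B) =
  (P (X 1%N @^-1` A) * \prod_(i <- iota 2 k) P (eps i @^-1` B i))%E.
Proof.
move=> mA mB.
rewrite indX1//; last first.
  apply: (@bigcap_measurableType _ (g_sigma_algebraType _)) => i /=.
  rewrite mem_iota => /andP[i2 _].
  apply: sub_sigma_algebra; exists i => //; exists (B i) => //.
  by rewrite setTI.
congr (_ * _)%E; apply: ind_eps => //; first exact: iota_uniq.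
by move=> i; rewrite mem_iota => /andP[i2 _] /=; exact: ltnW.
Qed.

Let past_measurable k : past k `<=` measurable.
Proof.
move=> _ [A [B [mA mB ->]]]; apply: measurableI.
  by rewrite -[_ @^-1` _]setTI; exact: measurable_funPT.
apply: bigcap_measurableType => i _.
by rewrite -[_ @^-1` _]setTI; exact: measurable_funPT.
Qed.

Let past_setI k : setI_closed (past k).
Proof.
move=> _ _ [A [B [mA mB ->]]] [A' [B' [mA' mB' ->]]].
exists (A `&` A'), (fun i => B i `&` B' i); split.
- exact: measurableI.
- by move=> i; exact: measurableI.
- by rewrite preimage_setI setIACA /box -bigcapI.
Qed.

Let past_setT k : past k setT.
Proof.
exists setT, (fun _ => setT); split=> //.
by rewrite preimage_setT setTI; apply/seteqP; split.
Qed.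

Let past_indep k G C : past k G -> measurable C ->
  P (G `&` eps k.+2 @^-1` C) = (P G * P (eps k.+2 @^-1` C))%E.
Proof.
move=> [A [B [mA mB ->]]] mC.
pose B' i := if i == k.+2 then C else B i.
have mB' i : measurable (B' i) by rewrite /B'; case: ifP.
have B'E i : i \in iota 2 k -> B' i = B i.
  by rewrite mem_iota add2n => /andP[_ ik]; rewrite /B' lt_eqF.
have -> : X 1%N @^-1` A `&` box k B `&` eps k.+2 @^-1` C =
          X 1%N @^-1` A `&` box k.+1 B'.
  rewrite -setIA /box iota2S; congr (_ `&` _); apply/seteqP; split => w.
  - move=> [wB wC] i /=; rewrite mem_rcons inE => /predU1P[->|ik].
      by rewrite /B' eqxx.
    by rewrite B'E//; exact: wB.
  - move=> wB; split.
      move=> i /= ik; rewrite -B'E//; apply: wB => /=.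
      by rewrite mem_rcons inE ik orbT.
    have := wB k.+2; rewrite /= /B' eqxx; apply.
    by rewrite mem_rcons mem_head.
rewrite !P_box// -muleA; congr (_ * _)%E.
rewrite iota2S -cats1 big_cat big_seq1 /B' eqxx; congr (_ * _)%E.
by rewrite big_seq [RHS]big_seq; apply: eq_bigr => i ik; rewrite -/(B' i) B'E.
Qed.

(** The finite measures P (. `&` E) and P E * P coincide on a pi-system, hence
on the sigma-algebra that it generates. *)
Let sigma_past_indep k G C : <<s past k >> G -> measurable C ->
  P (G `&` eps k.+2 @^-1` C) = (P G * P (eps k.+2 @^-1` C))%E.
Proof.
move=> sG mC; set E := eps k.+2 @^-1` C.
have mE : measurable E by rewrite -[E]setTI; exact: measurable_funPT.
have PE : P E \is a fin_num by exact: fin_num_measure.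
pose r : {nonneg R} := NngNum (fine_ge0 (measure_ge0 P E)).
have rP (A : set Omega) : mscale r P A = (P A * P E)%E.
  by rewrite /mscale/= fineK// muleC.
rewrite -rP.
apply: (g_sigma_algebra_measure_unique (past k) _ (fun _ => setT)
  _ _ (mrestr P mE) (mscale r P)) => //.
- by rewrite bigcup_const.
- by move=> A pA; rewrite [RHS]rP; exact: past_indep.
- move=> _; rewrite /mrestr; apply: le_lt_trans (ltry 1).
  by apply: probability_le1; exact: measurableI.
Qed.

Let T k := g_sigma_algebraType (past k).

Let measurable_eps_past k i : (2 <= i < k.+2)%N ->
  measurable_fun setT (eps i : T k -> TY).
Proof.
move=> ik _ C mC; rewrite setTI; apply: sub_sigma_algebra.
exists setT, (fun j => if j == i then C else setT); split => //.
  by move=> j; case: ifP.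
rewrite preimage_setT setTI; apply/seteqP; split => w /=.
  by move=> wC j _ /=; case: eqP => // ->.
move=> /(_ i) /=; rewrite eqxx; apply.
by rewrite mem_iota add2n.
Qed.

Let measurable_state_past k j : (j <= k)%N ->
  measurable_fun setT (X j.+1 : T k -> TX).
Proof.
elim: j => [_|j IH jk].
  move=> _ C mC; rewrite setTI; apply: sub_sigma_algebra.
  exists C, (fun _ => setT); split => //.
  by rewrite [box _ _](_ : _ = setT) ?setIT//; apply/seteqP; split.
rewrite [X in measurable_fun _ X](_ : _ =
  fun w => F (X j.+1 w, eps j.+2 w)); last first.
  by apply/funext => w; rewrite chain.
apply: measurableT_comp => //; apply: measurable_fun_pair.
  by apply: IH; exact: ltnW.
by apply: measurable_eps_past.
Qed.

Let measurable_history_past k j : (j <= k)%N ->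
  measurable_fun setT
    (history (fun i => X i : Omega -> TX) j : T k -> j.+1.-tuple TX).
Proof.
elim: j => [_|j IH jk] /=; apply: measurable_cons.
- exact: measurable_state_past.
- exact: measurable_cst.
- exact: measurable_state_past.
- by apply: IH; exact: ltnW.
Qed.

Lemma measurable_history k :
  measurable_fun setT (history (fun i => X i : Omega -> TX) k).
Proof.
elim: k => [|k IH] /=; apply: measurable_cons => //; exact: measurable_cst.
Qed.

(** Unrolling the recursion, the history up to time k+1 is measurable with respect
to X_1 and eps_2, .., eps_(k+1), all of which are independent of eps_(k+2). *)
Lemma history_indep k (A : set (k.+1.-tuple TX)) C :
  measurable A -> measurable C ->
  P (history (fun i => X i : Omega -> TX) k @^-1` A `&` eps k.+2 @^-1` C) =
  (P (history (fun i => X i : Omega -> TX) k @^-1` A) * P (eps k.+2 @^-1` C))%E.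
Proof.
move=> mA; apply: sigma_past_indep.
by have := measurable_history_past (leqnn k) measurableT mA; rewrite setTI.
Qed.

End history_independence.

(** * Backward induction along the chain *)

Section geomsum.
Context {R : realType}.
Variable rho : R.
Hypothesis rho0 : 0 <= rho.

Lemma geomsum0 : geomsum rho 0 = 1.
Proof. by rewrite /geomsum big_nat1 expr0. Qed.

Lemma geomsumS k : geomsum rho k.+1 = 1 + rho * geomsum rho k.
Proof.
rewrite /geomsum big_nat_recl// expr0 mulr_sumr; congr (_ + _).
by apply: eq_bigr => i _; rewrite exprS.
Qed.

Lemma geomsum_ge1 k : 1 <= geomsum rho k.
Proof.
rewrite /geomsum big_nat_recl// expr0 lerDl; apply: sumr_ge0 => i _.
exact: exprn_ge0.
Qed.

Lemma geomsum_ge0 k : 0 <= geomsum rho k.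
Proof. exact: le_trans (geomsum_ge1 k). Qed.

Lemma geomsum_le i j : (i <= j)%N -> geomsum rho i <= geomsum rho j.
Proof.
move=> /subnK <-; elim: (j - i)%N => [//|k IH]; rewrite addSn.
by apply: le_trans IH _; rewrite /geomsum [leRHS]big_nat_recr//= lerDl exprn_ge0.
Qed.

End geomsum.

Section newest_lipschitz.
Context {R : realType} {S : completeMetricType R}.

(** The class of functions of the history stable under averaging over the next
innovation: only the constant in the newest state changes. *)
Definition newest_lipschitz k (a : R) (g : k.+1.-tuple S -> R) :=
  forall x x', `|g x - g x'| <= a * mdist (thead x) (thead x') +
    \sum_(i < k) mdist (tnth x (lift ord0 i)) (tnth x' (lift ord0 i)).

Lemma measurable_newest_lipschitz k a (g : k.+1.-tuple S -> R) :
  separable_space S -> 0 <= a -> newest_lipschitz a g ->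
  measurable_fun setT (g : k.+1.-tuple (borel S) -> R).
Proof.
move=> sepS a0 lg.
rewrite (_ : g = fun x => g [tuple tnth x i | i < k.+1]); last first.
  by apply/funext => x; congr g; apply: eq_from_tnth => i; rewrite tnth_mktuple.
apply: (@measurable_lipschitz_tuple _ S _ (k.+1.-tuple (borel S)) _
  (fun i x => tnth x i) (fun i => if i == ord0 then a else 1)) => //.
- by move=> i; exact: measurable_tnth.
- by move=> i; case: ifP.
- move=> x x'; apply: le_trans (lg x x') _.
  rewrite big_ord_recl eqxx lerD2l le_eqVlt; apply/orP; left; apply/eqP.
  by apply: eq_bigr => i _; rewrite mul1r.
Qed.

End newest_lipschitz.

Section chain_mgf.
Context {R : realType} {SX SY : completeMetricType R}.
Hypotheses (sepX : separable_space SX) (sepY : separable_space SY).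
Context {d : measure_display} {Omega : measurableType d}.
Variables (P : probability Omega R).
Variables (eps : nat -> {RV P >-> borel SY}) (X : nat -> {RV P >-> borel SX}).
Hypotheses (iid_eps : iid [set i | (1 <= i)%N] eps)
  (indep_X1 : independent_of_family (X 1%N) [set i | (2 <= i)%N] eps).
Variable F : SX * SY -> SX.
Hypotheses (measF : measurable_fun [set: borel SX * borel SY]
             (F : borel SX * borel SY -> borel SX))
  (chain : forall k : nat, (2 <= k)%N ->
     forall w : Omega, X k w = F (X k.-1 w, eps k w)).
Variables (rho C : R).
Hypotheses (rho0 : 0 <= rho) (C_gt0 : 0 < C)
  (contractF : forall x x' : SX,
     ('E_P[fun w => mdist (F (x, eps 1%N w)) (F (x', eps 1%N w))]
        <= (rho * mdist x x')%:E)%E)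
  (lipF : forall (x : SX) (y y' : SY),
     mdist (F (x, y)) (F (x, y')) <= C * mdist y y').

Let nu : probability (borel SY) R := distribution P (eps 1%N).
Let Geps : borel SY -> \bar R := mean_dist C nu.

Hypothesis Geps_lty : forall y, (Geps y < +oo)%E.

Let C0 : 0 <= C. Proof. exact: ltW. Qed.

Let step k (x : k.+1.-tuple SX) (y : SY) : k.+2.-tuple SX :=
  [tuple of F (thead x, y) :: x].

(** The conditional expectation of [g], a function of the history up to time k+2,
given the history [x] up to time k+1. *)
Definition average k (g : k.+2.-tuple SX -> R) (x : k.+1.-tuple SX) : R :=
  \int[nu]_y g (step x y).

Let measurable_F x : measurable_fun setT (fun y : borel SY => F (x, y) : borel SX).
Proof.
by apply: (measurableT_comp measF); apply: measurable_fun_pair.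
Qed.

Let step_lip k a (g : k.+2.-tuple SX -> R) x : 0 <= a -> newest_lipschitz a g ->
  forall y y', `|g (step x y) - g (step x y')| <= a * (C * mdist y y').
Proof.
move=> a0 lg y y'; apply: le_trans (lg _ _) _.
rewrite big1 ?addr0; last by move=> i _; rewrite /step !tnthS mdistxx.
by rewrite !theadE ler_wpM2l.
Qed.

Let contract_nu x x' :
  (\int[nu]_y (mdist (F (x, y)) (F (x', y)))%:E <= (rho * mdist x x')%:E)%E.
Proof.
apply: le_trans (contractF x x'); rewrite unlock ge0_integral_distribution//.
  by apply/measurable_EFinP; apply: measurable_mdist2 => //; exact: measurable_F.
by move=> y; rewrite lee_fin mdist_ge0.
Qed.

Let integrable_dist_F x x' :
  nu.-integrable setT (fun y : borel SY => (mdist (F (x, y)) (F (x', y)))%:E).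
Proof.
apply/integrableP; split.
  by apply/measurable_EFinP; apply: measurable_mdist2 => //; exact: measurable_F.
under eq_integral do rewrite gee0_abs ?lee_fin ?mdist_ge0//.
exact: le_lt_trans (contract_nu x x') (ltry _).
Qed.

(** Changing the current state moves the next one by at most [rho] times as much
in mean, which contributes [rho * a]; the state itself becomes an older coordinate at the
next time, which contributes 1. *)
Lemma average_lipschitz k a (g : k.+2.-tuple SX -> R) : 0 <= a ->
  newest_lipschitz a g -> newest_lipschitz (1 + rho * a) (average g).
Proof.
move=> a0 lg x x'.
have ig z : nu.-integrable setT (EFin \o (fun y : borel SY => g (step z y))).
  exact: (integrable_observable sepY C0 Geps_lty a0 (step_lip z a0 lg)).
rewrite /average -RintegralB//.
have idg : nu.-integrable setT
    (EFin \o (fun y : borel SY => g (step x y) - g (step x' y))).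
  by under [_ \o _]eq_fun do rewrite /= EFinB;
    exact: (integrableB _ (ig x) (ig x')).
apply: le_trans (le_normr_Rintegral _ idg) _ => //.
set s := \sum_(i < k) _.
have iad : nu.-integrable setT (EFin \o
    (fun y : borel SY => a * mdist (F (thead x, y)) (F (thead x', y)))).
  by under [_ \o _]eq_fun do rewrite /= EFinM;
    exact: (integrableZl _ _ (integrable_dist_F _ _)).
have icst : nu.-integrable setT
    (EFin \o (fun=> mdist (thead x) (thead x') + s)).
  exact: finite_measure_integrable_cst.
apply: (@le_trans _ _ (\int[nu]_y (a * mdist (F (thead x, y)) (F (thead x', y))
    + (mdist (thead x) (thead x') + s)))).
  apply: le_Rintegral => //.
  - exact: integrable_norm.
  - by under [_ \o _]eq_fun do rewrite /= EFinD;
      exact: (integrableD _ iad icst).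
  - move=> y _; apply: le_trans (lg _ _) _.
    rewrite !theadE lerD2l big_ord_recl !tnthS lerD2l.
    by apply: ler_sum => i _; rewrite !tnthS.
rewrite RintegralD// Rintegral_cst// [X in fine X](@probability_setT _ _ _ nu) mulr1.
rewrite RintegralZl//; last exact: integrable_dist_F.
have : \int[nu]_y mdist (F (thead x, y)) (F (thead x', y)) <=
       rho * mdist (thead x) (thead x').
  rewrite -lee_fin fineK; last by apply: integrable_fin_num.
  exact: contract_nu.
move=> /(ler_wpM2l a0); lra.
Qed.

Variables (M V1 V2 : R).
Hypotheses (M0 : 0 <= M) (V1_ge0 : 0 <= V1) (V2_ge0 : 0 <= V2).

Let mu : probability (borel SX) R := distribution P (X 1%N).
Let G1 : borel SX -> \bar R := mean_dist 1 mu.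
Hypothesis G1_lty : forall x, (G1 x < +oo)%E.

Hypotheses
  (momX : forall k : nat, (2 <= k)%N ->
     (\int[mu]_x (G1 x ^+ k) <= (k`!%:R / 2 * V1 * M ^+ (k - 2))%:E)%E)
  (momE : forall k : nat, (2 <= k)%N ->
     (\int[nu]_y (Geps y ^+ k) <= (k`!%:R / 2 * V2 * M ^+ (k - 2))%:E)%E).

(** The variance factor at time k+1 of a function whose constant in the newest
state is [geomsum rho m]: the constant grows to [geomsum rho (m + k)] on the way
back to X_1. *)
Definition history_V (m k : nat) : R :=
  V1 * geomsum rho (m + k) ^+ 2 + V2 * \sum_(j < k) geomsum rho (m + j) ^+ 2.

Lemma history_VS m k :
  history_V m k.+1 = V2 * geomsum rho m ^+ 2 + history_V m.+1 k.
Proof.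
rewrite /history_V big_ord_recl addn0 addSnnS mulrDr addrCA; congr (_ + (_ + _ * _)).
by apply: eq_bigr => j _; rewrite addSnnS.
Qed.

Let H k := history (fun i => X i : Omega -> borel SX) k.

Let mH k : measurable_fun setT (H k).
Proof. exact: measurable_history. Qed.

Let indep_step k (A : set (k.+1.-tuple (borel SX))) (B : set (borel SY)) :
  measurable A -> measurable B ->
  P (H k @^-1` A `&` eps k.+2 @^-1` B) = (P (H k @^-1` A) * nu B)%E.
Proof.
move=> mA mB; have [ind idd] := iid_eps.
rewrite (history_indep ind indep_X1 measF chain)//; congr (_ * _)%E.
exact: idd.
Qed.

(** Induction on time: the claim for [g] at time k+2 follows from the claim for
[average g], of constant [geomsum rho m.+1], at time k+1.  Given the past, [g]
deviates from [average g] by at most [geomsum rho m * Geps]; this yields the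
factor [expR b], whose denominator is enlarged to the common one since
[geomsum rho m] is at most [geomsum rho (m.+1 + k)].  Both signs of [s] occur, as
needed for the two tails. *)
Lemma history_mgf k m (g : k.+1.-tuple SX -> R) :
  newest_lipschitz (geomsum rho m) g ->
  P.-integrable setT (fun w => (g (H k w))%:E) /\
  forall s, `|s| * (M * geomsum rho (m + k)) < 1 ->
    (\int[P]_w (expR (s * (g (H k w) - \int[P]_w' g (H k w'))))%:E
     <= (expR (s ^+ 2 * history_V m k /
               (2 * (1 - `|s| * (M * geomsum rho (m + k))))))%:E)%E.
Proof.
elim: k m g => [|k IH] m g lg.
  pose phi x := g [tuple x].
  have lphi x x' : `|phi x - phi x'| <= geomsum rho m * (1 * mdist x x').
    by apply: le_trans (lg _ _) _; rewrite big_ord0 addr0 mul1r !theadE.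
  have K0 := geomsum_ge0 rho0 m.
  have mphi : measurable_fun setT (phi : borel SX -> R).
    exact: measurable_observable lphi.
  have imu : mu.-integrable setT (EFin \o (phi : borel SX -> R)).
    exact: (integrable_observable sepX _ G1_lty K0 lphi).
  have iP := integrable_distribution imu.
  split; first exact: iP.
  move=> s; rewrite addn0 [M * _]mulrC => sM.
  have cE : \int[P]_w' g (H 0 w') = \int[mu]_x phi x.
    rewrite /Rintegral integral_distribution//; exact/measurable_EFinP.
  have := observable_mgf sepX ler01 G1_lty K0 lphi V1_ge0 M0 momX sM.
  rewrite -cE ge0_integral_distribution//.
    by rewrite /history_V big_ord0 mulr0 addr0 addn0.
  apply/measurable_EFinP; apply: measurableT_comp => //.
  by apply: measurable_funM => //; apply: measurable_funB.
have K0 := geomsum_ge0 rho0 m.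
have lav := average_lipschitz K0 lg; rewrite -geomsumS in lav.
have [iav mgf_av] := IH _ _ lav.
have mg := measurable_newest_lipschitz sepX K0 lg.
have mav := measurable_newest_lipschitz sepX (geomsum_ge0 rho0 m.+1) lav.
pose h (z : k.+1.-tuple (borel SX) * borel SY) := g (step z.1 z.2).
have mh : measurable_fun setT h.
  apply: (measurableT_comp mg); apply: measurable_cons => //.
  apply: (measurableT_comp measF); apply: measurable_fun_pair => //.
  by apply: (measurableT_comp (measurable_tnth ord0)).
pose U : {RV P >-> k.+1.-tuple (borel SX)} :=
  HB.pack (H k) (isMeasurableFun.Build _ _ _ _ _ (mH (k := k))).
have hU w : g (H k.+1 w) = h (U w, eps k.+2 w).
  by rewrite /h /step /= thead_history /H /= chain.
have iE := integrable_mean_dist sepY C0 Geps_lty.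
have ih u : nu.-integrable setT (EFin \o (fun y : borel SY => g (step u y))).
  exact: (integrable_observable sepY C0 Geps_lty K0 (step_lip u K0 lg)).
have [ihP EhP] : P.-integrable setT (fun w => (h (U w, eps k.+2 w))%:E) /\
    (\int[P]_w (h (U w, eps k.+2 w))%:E = \int[P]_w (average g (U w))%:E)%E.
  apply: (@indep_integral _ _ _ _ _ _ _ P U (eps k.+2) nu _ h (average g)
    (fun y => geomsum rho m * fine (Geps y))) => //.
  - exact: indep_step.
  - under [_ \o _]eq_fun do rewrite /= EFinM.
    exact: integrableZl.
  - move=> u y.
    exact: (observable_dev sepY C0 Geps_lty K0 (step_lip u K0 lg)).
  - by move=> u; rewrite /average /Rintegral fineK//;
      apply: integrable_fin_num => //; exact: ih.
split; first by under eq_fun do rewrite hU.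
move=> s; rewrite -addSnnS => sM.
have -> : \int[P]_w' g (H k.+1 w') = \int[P]_w' average g (H k w').
  by rewrite /Rintegral; under eq_integral do rewrite hU; rewrite EhP.
set c := \int[P]_w' _.
under eq_integral do rewrite hU.
rewrite (indep_ge0_integral (nu := nu) _
  (f := fun z => (expR (s * (h z - c)))%:E))//; last 2 first.
  exact: indep_step.
  apply/measurable_EFinP; apply: measurableT_comp => //.
  by apply: measurable_funM => //; apply: measurable_funB.
pose D := `|s| * (M * geomsum rho (m.+1 + k)).
have sMm : `|s| * (geomsum rho m * M) <= D.
  by rewrite /D ler_wpM2l// mulrC ler_wpM2l// geomsum_le// addSn leqW// leq_addr.
pose b := s ^+ 2 * (V2 * geomsum rho m ^+ 2) /
  (2 * (1 - `|s| * (geomsum rho m * M))).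
(* The conditional Bernstein bound: [average g u] is the mean of the integrand's
   [h (u, y)] when the past [u] is fixed. *)
have inner u : (\int[nu]_y (expR (s * (h (u, y) - c)))%:E <=
    (expR b)%:E * (expR (s * (average g u - c)))%:E)%E.
  have mhu : measurable_fun setT (fun y : borel SY => g (step u y)).
    by apply/measurable_EFinP; exact: measurable_int (ih u).
  rewrite (eq_integral (fun y : borel SY => (expR (s * (average g u - c)))%:E *
      (expR (s * (g (step u y) - average g u)))%:E)%E); last first.
    by move=> y _; rewrite -EFinM -expRD; congr (expR _)%:E; rewrite /h/=; ring.
  rewrite ge0_integralZl_EFin ?expR_ge0//; last first.
    apply/measurable_EFinP; apply: measurableT_comp => //.
    by apply: measurable_funM => //; apply: measurable_funB.
  rewrite muleC lee_wpmul2r ?lee_fin ?expR_ge0//.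
  apply: (observable_mgf sepY C0 Geps_lty K0 (step_lip u K0 lg) V2_ge0 M0 momE).
  exact: le_lt_trans sMm sM.
have mexp (f : k.+1.-tuple (borel SX) -> R) : measurable_fun setT f ->
    measurable_fun setT (fun u => (expR (s * (f u - c)))%:E).
  move=> mf; apply/measurable_EFinP; apply: measurableT_comp => //.
  by apply: measurable_funM => //; apply: measurable_funB.
apply: (@le_trans _ _ (\int[distribution P U]_u
    ((expR b)%:E * (expR (s * (average g u - c)))%:E))%E).
  apply: ge0_le_integral => //.
  - by move=> u _; apply: integral_ge0 => y _; rewrite lee_fin expR_ge0.
  - apply: (measurable_fun_fubini_tonelli_F
      (fun z => (expR (s * (h z - c)))%:E)).
      apply/measurable_EFinP; apply: measurableT_comp => //.
      by apply: measurable_funM => //; apply: measurable_funB.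
    by move=> z; rewrite lee_fin expR_ge0.
  - by apply: measurable_funeM; exact: mexp.
rewrite ge0_integralZl_EFin ?expR_ge0//; last first.
  exact: mexp.
rewrite ge0_integral_distribution//; last first.
  exact: mexp.
apply: le_trans (lee_wpmul2l _ (mgf_av s sM)) _; first by rewrite lee_fin expR_ge0.
rewrite -EFinM -expRD lee_fin ler_expR history_VS -/D.
set W := history_V m.+1 k.
rewrite [s ^+ 2 * (_ + W)]mulrDr [leRHS]mulrDl lerD2r /b ler_wpM2l//.
  by rewrite mulr_ge0 ?sqr_ge0// mulr_ge0 ?sqr_ge0.
rewrite lef_pV2 ?posrE ?mulr_gt0 ?subr_gt0//; last exact: le_lt_trans sMm sM.
by rewrite ler_pM2l// lerD2l lerN2.
Qed.

End chain_mgf.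

(** * The deviation inequalities *)

(** Transfer to the law of [Z]; finiteness follows from the moment of order 2. *)
Lemma mean_dist_moments (R : realType) (S : completeMetricType R)
    d (Omega : measurableType d) (P : probability Omega R)
    (Z : {RV P >-> borel S}) (c : R) (B : nat -> R) :
  separable_space S -> 0 <= c ->
  (forall k, (2 <= k)%N ->
     (\int[P]_w (mean_dist c (distribution P Z) (Z w) ^+ k) <= (B k)%:E)%E) ->
  (forall k, (2 <= k)%N ->
     (\int[distribution P Z]_x (mean_dist c (distribution P Z) x ^+ k)
        <= (B k)%:E)%E) /\
  (forall x, (mean_dist c (distribution P Z) x < +oo)%E).
Proof.
move=> sepS c0 momZ.
have mom k : (2 <= k)%N -> (\int[distribution P Z]_x
    (mean_dist c (distribution P Z) x ^+ k) <= (B k)%:E)%E.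
  move=> k2; apply: le_trans (momZ k k2).
  rewrite ge0_integral_distribution//.
    by apply: measurable_fun_expe; exact: measurable_mean_dist.
  by move=> x; rewrite expe_ge0// mean_dist_ge0.
split=> //; apply: mean_dist_lty => //.
exact: le_lt_trans (mom 2%N isT) (ltry _).
Qed.

Lemma tnth_history (Omega S : Type) (X : nat -> Omega -> S) k w (i : 'I_k.+1) :
  tnth (history X k w) i = X (k.+1 - i)%N w.
Proof.
elim: k i => [|k IH] i; first by rewrite ord1.
case: (unliftP ord0 i) => [j ->|->] //=.
by rewrite tnthS IH.
Qed.

Lemma bernstein_VE (R : realType) (rho V1 V2 : R) k :
  bernstein_V k.+1 rho V1 V2 = history_V rho V1 V2 0 k.
Proof.
rewrite /bernstein_V /history_V /= add0n; congr (_ + _ * _).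
rewrite -[2%N]add0n big_addn -addn2 addnK big_mkord (reindex_inj rev_ord_inj).
by apply: eq_bigr => i _ /=; congr (geomsum _ _ ^+ 2); have := ltn_ord i; lia.
Qed.

Theorem proposition3p1 (R : realType)
  (SX SY : completeMetricType R)
  (sepX : separable_space SX) (sepY : separable_space SY)
  (d : measure_display) (Omega : measurableType d) (P : probability Omega R)
  (eps : nat -> {RV P >-> borel SY})
  (iid_eps : iid [set i | (1 <= i)%N] eps)
  (X : nat -> {RV P >-> borel SX})
  (indep_X1 : independent_of_family (X 1%N) [set i | (2 <= i)%N] eps)
  (F : SX * SY -> SX)
  (measF : measurable_fun [set: borel SX * borel SY]
             (F : borel SX * borel SY -> borel SX))
  (chain : forall k : nat, (2 <= k)%N ->
     forall w : Omega, X k w = F (X k.-1 w, eps k w))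
  (rho C : R) (rho01 : 0 <= rho < 1) (C_gt0 : 0 < C)
  (contractF : forall x x' : SX,
     ('E_P[fun w => mdist (F (x, eps 1%N w)) (F (x', eps 1%N w))]
        <= (rho * mdist x x')%:E)%E)
  (lipF : forall (x : SX) (y y' : SY),
     mdist (F (x, y)) (F (x, y')) <= C * mdist y y')
  (n : nat) (n_ge1 : (1 <= n)%N)
  (f : n.-tuple SX -> R)
  (lipf : forall x x' : n.-tuple SX,
     `|f x - f x'| <= \sum_(i < n) mdist (tnth x i) (tnth x' i))
  (M V1 V2 : R) (M_gt0 : 0 < M) (V1_ge0 : 0 <= V1) (V2_ge0 : 0 <= V2)
  (momX : forall k : nat, (2 <= k)%N ->
     (\int[P]_w (mean_dist 1 (distribution P (X 1%N)) (X 1%N w) ^+ k)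
        <= (k`!%:R / 2 * V1 * M ^+ (k - 2))%:E)%E)
  (momE : forall k : nat, (2 <= k)%N ->
     (\int[P]_w (mean_dist C (distribution P (eps 1%N)) (eps 1%N w) ^+ k)
        <= (k`!%:R / 2 * V2 * M ^+ (k - 2))%:E)%E) :
  let S : Omega -> R := centered P (fun w => f [tuple X i.+1 w | i < n]) in
  let V := bernstein_V n rho V1 V2 in
  let Delta := bernstein_Delta n rho M in
  (forall (b : bool) (t : R), 0 <= t < Delta^-1 ->
     ('E_P[fun w => expR ((-1) ^+ b * (t * S w))]
        <= (expR (t ^+ 2 * V / (2 * (1 - t * Delta))))%:E)%E) /\
  (forall (b : bool) (x : R), 0 < x ->
     (P [set w | (x <= (-1) ^+ b * S w)%R]
        <= (expR (- (x ^+ 2 / bernstein_denom V Delta x)))%:E)%E /\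
     expR (- (x ^+ 2 / bernstein_denom V Delta x))
        <= expR (- (x ^+ 2 / (2 * (V + x * Delta))))).
Proof.
move=> S V Delta.
have rho0 : 0 <= rho by case/andP: rho01.
have C0 := ltW C_gt0; have M0 := ltW M_gt0.
have [momX' G1lty] := mean_dist_moments sepX ler01 momX.
have [momE' Gelty] := mean_dist_moments sepY C0 momE.
case: n n_ge1 f lipf @S @V @Delta => // k _ f0 lipf0 S V Delta.
(* The history lists the newest state first. *)
pose g (x : k.+1.-tuple SX) := f0 [tuple tnth x (rev_ord i) | i < k.+1].
have lg : newest_lipschitz (geomsum rho 0) g.
  move=> x x'; apply: le_trans (lipf0 _ _) _.
  rewrite geomsum0 mul1r (reindex_inj rev_ord_inj) big_ord_recl /=.
  rewrite !tnth_mktuple !rev_ordK lerD2l; apply: ler_sum => i _.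
  by rewrite !tnth_mktuple !rev_ordK.
pose H := history (fun i => X i : Omega -> borel SX) k.
have fH w : f0 [tuple X i.+1 w | i < k.+1] = g (H w).
  congr f0; apply: eq_from_tnth => i; rewrite !tnth_mktuple tnth_history /=.
  by rewrite subKn.
have [ig mgf] := history_mgf sepX sepY iid_eps indep_X1 measF chain rho0 C_gt0
  contractF lipF Gelty M0 V1_ge0 V2_ge0 G1lty momX' momE' lg.
have SE w : S w = g (H w) - \int[P]_w' g (H w').
  rewrite /S /centered unlock fH /Rintegral; congr (_ - fine _).
  by apply: eq_integral => w' _; rewrite fH.
have mS : measurable_fun setT S.
  rewrite (_ : S = fun w => g (H w) - \int[P]_w' g (H w')); last exact/funext.
  apply: measurable_funB => //.
  by apply/measurable_EFinP; exact: measurable_int ig.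
have Delta_gt0 : 0 < Delta.
  by rewrite mulr_gt0// (lt_le_trans ltr01)// geomsum_ge1.
have V_ge0 : 0 <= V.
  apply: addr_ge0; apply: mulr_ge0 => //; first exact: sqr_ge0.
  by apply: sumr_ge0 => i _; exact: sqr_ge0.
have mgfS (b : bool) t : 0 <= t < Delta^-1 ->
    ('E_P[fun w => expR ((-1) ^+ b * (t * S w))]
      <= (expR (t ^+ 2 * V / (2 * (1 - t * Delta))))%:E)%E.
  move=> /andP[t0 tD].
  have tDelta : t * Delta < 1 by rewrite -ltr_pdivlMr// div1r.
  have := mgf ((-1) ^+ b * t).
  rewrite normrM normrX normrN1 expr1n mul1r (ger0_norm t0) exprMn sqrr_sign mul1r.
  rewrite add0n -/Delta -bernstein_VE -/V => /(_ tDelta).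
  by rewrite unlock; under eq_integral do rewrite -SE -mulrA.
split=> // b x x0; split.
- pose Y : {RV P >-> R} := HB.pack (fun w => (-1) ^+ b * S w)
    (isMeasurableFun.Build _ _ _ _ _ (measurable_funM (measurable_cst _) mS)).
  pose A := [set w | x <= (-1) ^+ b * S w].
  have mA : measurable A.
    rewrite (_ : A = Y @^-1` `[x, +oo[%classic); last first.
      by apply/seteqP; split => w /=; rewrite in_itv/= andbT.
    by rewrite -[_ @^-1` _]setTI; exact: measurable_funPT.
  rewrite -/A -[P A]fineK ?fin_num_measure// lee_fin.
  apply: bernstein_tail => // t /andP[t0 tD].
  rewrite -lee_fin fineK ?fin_num_measure// EFinM.
  apply: le_trans (chernoff Y x t0) _.
  rewrite lee_wpmul2r ?lee_fin ?expR_ge0//.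
  apply: le_trans (mgfS b t _); last by rewrite (ltW t0).
  rewrite /mmt_gen_fun le_eqVlt; apply/orP; left; apply/eqP.
  by congr ('E_P[_])%E; apply/funext => w /=; rewrite mulrCA mulrC mulrA.
- have /andP[den0 denle] := bernstein_denom_le V_ge0 Delta_gt0 x0.
  rewrite ler_expR lerN2 ler_wpM2l ?sqr_ge0// lef_pV2 ?posrE//.
  exact: lt_le_trans den0 denle.
Qed.
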